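(* Let $S$ be a numerical semigroup and let $k$ be a nonnegative integer with $k<L(S)$. Then $S, A^{\star}(S),\dots,A^{\star k}(S)$ are all almost symmetric numerical semigroups if and only if the following two conditions hold for all integers $i$: (1) if $2i\in[0,k]$, then $t(A^{\star 2i}(S))=2g(S)-m_i(S)-F_{i+1}(S)$; (2) if $2i+1\in[0,k]$, then $t(A^{\star (2i+1)}(S))=F_{i+1}(S)-2g(S)+m_{i+1}(S)$.
   Context: $\mathbb{N}=\{0,1,2,\dots\}$. A numerical semigroup is a subset $S\subseteq\mathbb{N}$ containing $0$, closed under addition, with finite complement in $\mathbb{N}$. The elements of $\mathbb{N}\setminus S$ are the gaps of $S$; the genus $g(S)$ is the number of gaps; for $S\neq\mathbb{N}$ the Frobenius number $F(S)$ is the largest gap. The set of pseudo-Frobenius numbers is $PF(S)=\{x\in\mathbb{N}\setminus S \mid x+s\in S \text{ for all } s\in S\setminus\{0\}\}$, and the type is $t(S)=|PF(S)|$. A numerical semigroup $S\ne\mathbb{N}$ is almost symmetric if $t(S)=2g(S)-F(S)$. For a numerical semigroup $S$, $A^{\star}(S)=S\cup PF(S)$, which is again a numerical semigroup; $A^{\star j}$ denotes the $j$-fold iterate, with $A^{\star 0}(S)=S$ (and $A^{\star}(\mathbb{N})=\mathbb{N}$ for definiteness). $m_0(S)=0$ and for $i\geq 1$, $m_i(S)$ is the $i$-th positive element of $S$ in increasing order; for $1\leq i\leq g(S)$, $F_i(S)$ is the $i$-th largest gap of $S$. Put $l(S)=|S\cap[1,g(S)]|$; then $L(S)=2l(S)$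 if $g(S)\in S$, and $L(S)=2l(S)+1$ if $g(S)\notin S$. (Note $L(S)=0$ if and only if $S=\mathbb{N}$.) *)

(* Defs.v *)
From mathcomp Require Import all_boot all_order all_algebra finmap.
From mathcomp Require Import mathcomp_extra boolp classical_sets functions cardinality.

Set Implicit Arguments.
Unset Strict Implicit.
Unset Printing Implicit Defensive.

Local Open Scope classical_set_scope.

Definition numerical_semigroup (S : set nat) : Prop :=
  [/\ S 0, forall x y, S x -> S y -> S (x + y) & finite_set (~` S)].

(* [fset_set A] is a junk value (the empty set) when [A] is infinite, so the
   numerical invariants below are only meaningful for numerical semigroups. *)
Definition gaps (S : set nat) : {fset nat} := fset_set (~` S).

Definition genus (S : set nat) : nat := #|` gaps S|.

(* Equal to 0 by convention when S has no gap. *)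
Definition Frobenius (S : set nat) : nat := \max_(x <- gaps S) x.

Definition PF (S : set nat) : set nat :=
  [set x | ~ S x /\ forall s, S s -> s <> 0 -> S (x + s)].

Definition sg_type (S : set nat) : nat := #|` fset_set (PF S)|.

Definition almost_symmetric (S : set nat) : Prop :=
  [/\ numerical_semigroup S, S <> setT &
      (Posz (sg_type S) = 2 * Posz (genus S) - Posz (Frobenius S))%R].

(* PF setT is empty, so Astar setT = setT. *)
Definition Astar (S : set nat) : set nat := S `|` PF S.

Definition Astar_iter (j : nat) (S : set nat) : set nat := iter j Astar S.

(* The i-th positive element of S in increasing order, with value 0 at i = 0:
   each term is the least element of S exceeding the previous one. *)
Fixpoint m_ (i : nat) (S : set nat) : nat :=
  if i is i'.+1 then
    xget 0 [set x | [/\ S x, m_ i' S < x &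
                        forall y, S y -> m_ i' S < y -> x <= y]]
  else 0.

(* The i-th largest gap, 1 <= i <= genus S (so F_ 1 S is the largest one). *)
Definition F_ (i : nat) (S : set nat) : nat := nth 0 (sort geq (gaps S)) i.-1.

Definition l_ (S : set nat) : nat :=
  #|` fset_set (S `&` [set x | 1 <= x <= genus S])|.

Definition L_ (S : set nat) : nat :=
  if genus S \in S then 2 * l_ S else 2 * l_ S + 1.

(* Main.v *)
(* If [T] is almost symmetric with Frobenius number [f], the gaps of [A*(T)] are
   exactly the [f - s] with [s] in [T], [0 < s < f].  Iterating, as long as all
   the previous iterates are almost symmetric,
     - the gaps of [A*^(2i)(S)] are the [x - m_i] with [x] a gap of [S],
       [m_i < x <= F_(i+1)];
     - the gaps of [A*^(2i+1)(S)] are the [F_(i+1) - s] with [s] in [S],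
       [m_i < s < F_(i+1)].
   The bound [k < L(S)] ensures that [m_i < F_(i+1)] (resp.
   [m_(i+1) < F_(i+1)]), so these sets are nonempty and the Frobenius number and
   genus of the iterate can be read off.  Since [2 g - F] is then the right-hand
   side of (1) or (2), each of these equations says precisely that the
   corresponding iterate is almost symmetric, and one concludes by strong
   induction. *)
Require Import Defs.
From mathcomp Require Import all_boot all_order all_algebra finmap.
From mathcomp Require Import mathcomp_extra boolp classical_sets functions cardinality.
From mathcomp Require Import zify.

Set Implicit Arguments.
Unset Strict Implicit.
Unset Printing Implicit Defensive.

Local Open Scope classical_set_scope.

(** * Counting the elements of a set of integers below a bound *)

Definition count_below (A : set nat) (n : nat) : nat :=
  \sum_(0 <= x < n) (x \in A).

Lemma count_belowS A n : count_below A n.+1 = count_below A n + (n \in A).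
Proof. by rewrite /count_below big_nat_recr//=. Qed.

Lemma count_below_cat A m n : m <= n ->
  count_below A n = count_below A m + \sum_(m <= x < n) (x \in A).
Proof. by move=> mn; rewrite /count_below (@big_cat_nat _ _ _ m). Qed.

Lemma count_below_le A m n : m <= n -> count_below A m <= count_below A n.
Proof. by move=> /count_below_cat->; exact: leq_addr. Qed.

Lemma count_below_lt A m n : A m -> m < n -> count_below A m < count_below A n.
Proof.
move=> Am /(count_below_le A); apply: leq_trans.
by rewrite count_belowS mem_set// addn1.
Qed.

Lemma count_belowC A n : count_below A n + count_below (~` A) n = n.
Proof.
rewrite /count_below -big_split/=.
under eq_bigr do rewrite in_setC addnC addn_negb.
by rewrite sum_nat_const_nat subn0 muln1.
Qed.

Lemma size_count_below (s : seq nat) (A : set nat) n : uniq s ->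
  (forall x, x \in s <-> A x /\ x < n) -> size s = count_below A n.
Proof.
move=> us sA; rewrite /count_below -sum1_size.
have E : perm_eq s [seq x <- iota 0 n | x \in A].
  apply: uniq_perm => [||x]; rewrite ?filter_uniq ?iota_uniq//.
  rewrite mem_filter mem_iota/= add0n; apply/idP/andP.
    by move=> /sA[Ax xn]; rewrite mem_set.
  by case=> /set_mem Ax xn; apply/sA.
rewrite (perm_big _ E) big_filter big_mkcond/= /index_iota subn0.
by apply: eq_bigr => x _; case: (x \in A).
Qed.

Lemma card_fset_set_count (A : set nat) n : (forall x, A x -> x < n) ->
  #|` fset_set A| = count_below A n.
Proof.
move=> An; have fA : finite_set A.
  by apply: (sub_finite_set _ (finite_II n)) => x /An.
apply: size_count_below; first exact: fset_uniq.
move=> x; rewrite in_fset_set// in_setE.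
by split=> [Ax|[]//]; split=> //; exact: An.
Qed.

(** * Genus, conductor and Frobenius number *)

Lemma card_gaps_count S n : (forall x, n <= x -> S x) ->
  genus S = count_below (~` S) n.
Proof.
move=> Sn; apply: card_fset_set_count => x nSx.
by rewrite ltnNge; apply/negP => /Sn.
Qed.

Lemma in_gaps S x : numerical_semigroup S -> x \in gaps S <-> ~ S x.
Proof. by case=> _ _ fS; rewrite in_fset_set// in_setE. Qed.

Lemma numerical_semigroup_conductor S : numerical_semigroup S ->
  exists n, forall x, n <= x -> S x.
Proof.
move=> hS; exists (\max_(x <- gaps S) x).+1 => x xgt; apply: contrapT.
move=> /(in_gaps x hS) xS; move: xgt; rewrite ltnNge.
by rewrite (@leq_bigmax_seq _ _ xpredT id x).
Qed.

Lemma gaps_below_le S n : numerical_semigroup S ->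
  count_below (~` S) n <= genus S.
Proof.
move=> /numerical_semigroup_conductor[N SN].
rewrite (@card_gaps_count S (maxn n N)) ?count_below_le ?leq_maxl//.
by move=> x; rewrite geq_max => /andP[_ /SN].
Qed.

Lemma Frobenius_eq S f : numerical_semigroup S -> ~ S f ->
  (forall x, f < x -> S x) -> Frobenius S = f.
Proof.
move=> hS nSf Sf; apply/eqP; rewrite eqn_leq; apply/andP; split.
  apply/bigmax_leqP_seq => x /(in_gaps x hS) nSx _.
  by rewrite leqNgt; apply/negP => /Sf.
apply: (@leq_bigmax_seq _ _ xpredT id) => //; exact/in_gaps.
Qed.

Lemma FrobeniusP S : numerical_semigroup S -> S <> setT ->
  ~ S (Frobenius S) /\ (forall x, Frobenius S < x -> S x).
Proof.
move=> hS ST; have [n0 nS0] : exists n, ~ S n.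
  apply: contrapT => h; apply: ST; apply/seteqP; split=> // x _.
  by apply: contrapT => nSx; apply: h; exists x.
have [N SN] := numerical_semigroup_conductor hS.
have exP : exists n, `[< ~ S n >] by exists n0; exact/asboolP.
have ubP n : `[< ~ S n >] -> n <= N.
  by move=> /asboolP nSn; case: (leqP n N) => // /ltnW/SN.
case: (ex_maxnP exP ubP) => f /asboolP nSf fmax.
have Sf x : f < x -> S x.
  move=> fx; apply: contrapT => /asboolP/fmax; lia.
by rewrite (Frobenius_eq hS nSf Sf).
Qed.

(** * The operator [Astar] and its effect on almost symmetric semigroups *)

Lemma numerical_semigroup_Astar S :
  numerical_semigroup S -> numerical_semigroup (Astar S).
Proof.
move=> [S0 SD fS]; split.
- by left.
- move=> x y [Sx|[nSx xP]] [Sy|[nSy yP]].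
  + by left; exact: SD.
  + have [->|/eqP x0] := eqVneq x 0; first by right.
    by left; rewrite addnC; exact: yP.
  + have [->|/eqP y0] := eqVneq y 0; first by right; rewrite addn0.
    by left; exact: xP.
  + have [Sxy|nSxy] := pselect (S (x + y)); first by left.
    right; split=> // s Ss s0; rewrite -addnA; apply: xP; first exact: yP.
    by move/eqP; rewrite addn_eq0 => /andP[_ /eqP].
- by apply: sub_finite_set fS => x nx Sx; apply: nx; left.
Qed.

Lemma numerical_semigroup_Astar_iter j S :
  numerical_semigroup S -> numerical_semigroup (Astar_iter j S).
Proof.
by move=> hS; elim: j => // j IH; exact: numerical_semigroup_Astar.
Qed.

(* Pointwise on [0, F], [x in PF] + [F - x in S] <= [x notin S] + [x = F];
   summing gives t + (F + 1 - g) <= g + 1, so almost symmetry forces equality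
   at every x. *)
Lemma almost_symmetric_gap S x : almost_symmetric S -> ~ S x ->
  PF S x \/ S (Frobenius S - x).
Proof.
case=> hS ST tE nSx.
have [nSF SF] := FrobeniusP hS ST; have [S0 SD _] := hS.
set f := Frobenius S in tE nSF SF *.
have xf : x <= f by rewrite leqNgt; apply/negP => /SF.
have gE : genus S = count_below (~` S) f.+1 by exact: card_gaps_count.
have tE' : sg_type S = count_below (PF S) f.+1.
  apply: card_fset_set_count => y [nSy _].
  by rewrite ltnS leqNgt; apply/negP => /SF.
pose a y := (y \in PF S) + (f - y \in S); pose b y := (y \in ~` S) + (y == f).
have ab y : 0 <= y < f.+1 -> a y <= b y.
  rewrite ltnS /= => yf; rewrite /a /b.
  have [->|yNf] := eqVneq y f.
    by rewrite (@mem_set _ (~` S))//=; case: (_ \in PF S); case: (_ \in S).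
  have yltf : y < f by rewrite ltn_neqAle yNf.
  rewrite addn0; case: (boolP (y \in PF S)) => [/set_mem[nSy yP]|_].
    rewrite (@mem_set _ (~` S))// memNset// => Sfy; apply: nSF.
    by rewrite -(subnKC yf); apply: yP => //; lia.
  case: (boolP (f - y \in S)) => // /set_mem Sfy.
  rewrite (@mem_set _ (~` S))// => Sy.
  by apply: nSF; rewrite -(subnKC yf); exact: SD.
have suma : \sum_(0 <= y < f.+1) a y = sg_type S + count_below S f.+1.
  rewrite big_split/= tE'; congr (_ + _).
  rewrite /count_below [RHS]big_nat_rev/=; apply: eq_big_nat => y _.
  by rewrite add0n subSS.
have sumb : \sum_(0 <= y < f.+1) b y = (genus S).+1.
  rewrite big_split/= gE -[RHS]addn1; congr (_ + _).
  rewrite big_nat_recr//= eqxx big_nat big1 ?add0n// => y /= yf.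
  by rewrite (ltn_eqF yf).
have abx : a x = b x.
  have /eqP : \sum_(0 <= y < f.+1) (b y - a y) = 0.
    rewrite big_nat sumnB// -!big_nat suma sumb.
    have := count_belowC S f.+1; rewrite -gE; lia.
  rewrite sum_nat_seq_eq0 => /allP/(_ x); rewrite mem_index_iota => /(_ xf)/=.
  have := ab x xf; lia.
move: abx; rewrite /a /b (@mem_set _ (~` S))//.
case: (boolP (x \in PF S)) => [/set_mem|_]; first by left.
by case: (boolP (f - x \in S)) => [/set_mem|_]; first by right.
Qed.

(** With f the Frobenius number: a gap outside [PF S] has its mirror f - y in S, and y < f because f
    itself is pseudo-Frobenius. Conversely, if y lay in S or in [PF S], then y + (f - y) = f would
    lie in S. *)
Lemma almost_symmetric_Astar S y : almost_symmetric S ->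
  ~ Astar S y <-> y < Frobenius S /\ S (Frobenius S - y).
Proof.
move=> aS; have [hS ST _] := aS; have [nSF SF] := FrobeniusP hS ST.
have [S0 SD _] := hS.
split=> [nA|[yF SFy] [Sy|[nSy yP]]].
- have nSy : ~ S y by move=> ?; apply: nA; left.
  have [?|SFy] := almost_symmetric_gap aS nSy; first by case: nA; right.
  split=> //; rewrite ltn_neqAle; apply/andP; split.
    apply/eqP => yF; apply: nA; right; split=> // s Ss s0.
    by apply: SF; lia.
  by rewrite leqNgt; apply/negP => /SF.
- by apply: nSF; rewrite -(subnKC (ltnW yF)); exact: SD.
- by apply: nSF; rewrite -(subnKC (ltnW yF)); apply: yP => //; lia.
Qed.

(** * The sequences m_i and F_i, expressed through counting *)

Section invariants.
Variables (S : set nat) (hS : numerical_semigroup S).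
Let g := genus S.
Let m i := m_ i S.
Let F i := F_ i S.

Lemma m_succ i : [/\ S (m i.+1), m i < m i.+1 &
  forall y, S y -> m i < y -> m i.+1 <= y].
Proof.
have [N SN] := numerical_semigroup_conductor hS.
have exP : exists n, `[< S n >] && (m i < n).
  by exists (maxn N (m i).+1); rewrite leq_maxr andbT; apply/asboolP/SN/leq_maxl.
rewrite /m /=; apply: (@xgetPex _ 0 [set x | [/\ S x, m_ i S < x &
  forall y, S y -> m_ i S < y -> x <= y]]).
case: (ex_minnP exP) => n /andP[/asboolP Sn mn] nmin.
by exists n; split=> // y Sy my; apply: nmin; rewrite my andbT; exact/asboolP.
Qed.

Lemma m_mem i : S (m i).
Proof. by case: i => [|i]; [case: hS | case: (m_succ i)]. Qed.

(** Passing from m_i to m_(i+1) adds exactly the element m_i, since S has nothing strictly in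
    between. *)
Lemma count_below_m i : count_below S (m i) = i.
Proof.
elim: i => [|i IH]; first by rewrite /count_below big_geq.
have [Sm mm mmin] := m_succ i.
rewrite (count_below_cat _ mm) count_belowS IH mem_set ?addn1; last exact: m_mem.
rewrite big_nat big1 ?addn0// => y /andP[my ym].
by rewrite memNset// => /mmin/(_ my); lia.
Qed.

Lemma F_spec i : i < g ->
  ~ S (F i.+1) /\ count_below (~` S) (F i.+1) + i.+1 = g.
Proof.
move=> ig; pose s := sort geq (gaps S).
have sz : size s = g by rewrite size_sort.
have ss : sorted gtn s.
  rewrite gtn_sorted_uniq_geq sort_uniq fset_uniq /=.
  by apply: sort_sorted => x y; exact: leq_total.
have mem x : x \in s <-> ~ S x by rewrite mem_sort in_gaps.
have si : i < size s by rewrite sz.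
split; first by apply/mem; exact: mem_nth.
rewrite -(@size_count_below [seq x <- s | x < F i.+1]); first last.
- move=> x; rewrite mem_filter; split; first by move=> /andP[? /mem].
  by move=> [/mem -> ->].
- by rewrite filter_uniq// /s sort_uniq fset_uniq.
have := ss; rewrite sorted_pairwise; last by move=> x y z /= ? ?; lia.
have FE : F i.+1 = nth 0 s i by [].
have sE : s = take i s ++ F i.+1 :: drop i.+1 s.
  by rewrite FE -drop_nth// cat_take_drop.
(* The list is strictly decreasing: the i entries before F_(i+1) exceed it and all later ones are
   smaller, so the gaps below F_(i+1) are exactly the later entries. *)
rewrite {1}sE pairwise_cat/= => /and3P[tF _ /andP[Fd _]].
have sizes : size (take i s) + (size (drop i.+1 s)).+1 = g.
  by rewrite -sz {3}sE size_cat.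
have stake : size (take i s) = i by rewrite size_takel// ltnW.
rewrite {1}sE filter_cat/= ltnn size_cat !size_filter.
have -> : count (fun x => x < F i.+1) (take i s) = 0.
  apply/eqP; rewrite -leqn0 leqNgt -has_count; apply/hasPn => x xt.
  move/allrelP : tF => /(_ x (F i.+1) xt (mem_head _ _))/=; lia.
have /eqP-> : count (fun x => x < F i.+1) (drop i.+1 s) == size (drop i.+1 s).
  by rewrite -all_count.
lia.
Qed.

(** * Comparing m_i and F_i with the genus *)

Lemma count_below_l : count_below S g.+1 = (l_ S).+1.
Proof.
rewrite /l_ (@card_fset_set_count _ g.+1); last by move=> x [_ /= /andP[]].
rewrite /count_below !big_nat_recl//= mem_set; last by case: hS.
rewrite (@memNset _ _ 0)//=; last by case.
rewrite add0n add1n; congr _.+1; apply: eq_big_nat => x /andP[_ xg].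
congr (nat_of_bool _); apply/idP/idP => /set_mem.
  by move=> Sx; apply/mem_set; split.
by case=> Sx _; exact/mem_set.
Qed.

(** Of the g + 1 integers in [0, g], l + 1 lie in S (0 included), so g - l are gaps and the
    remaining l gaps exceed g. *)
Lemma F_gt_genus i : i < l_ S -> i < g /\ g < F i.+1.
Proof.
move=> il; have lg := count_below_l; have C := count_belowC S g.+1.
have ig : i < g by lia.
split=> //; have [nSF cF] := F_spec ig.
rewrite ltnNge; apply/negP; rewrite -ltnS => /(@count_below_lt (~` S) _ _ nSF).
lia.
Qed.

Lemma m_le_genus i : i <= l_ S -> m i <= g.
Proof.
move=> il; rewrite leqNgt; apply/negP => /(count_below_le S).
by rewrite count_below_m count_below_l; lia.
Qed.

Lemma m_lt_F_even i : 2 * i < L_ S -> i < g /\ m i < F i.+1.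
Proof.
have [il _|li] := ltnP i (l_ S).
  have [ig gF] := F_gt_genus il.
  by split=> //; apply: leq_ltn_trans gF; exact/m_le_genus/ltnW.
rewrite /L_; case: ifPn => [_|gS]; first by lia.
(* The extremal case, possible only when g is a gap. There are g - i - 1 gaps below g, as many as
   below F_(i+1), whence g <= F_(i+1); and m_i < g since m_i is in S. *)
move=> iL; have {li iL}il : i = l_ S by lia.
have lg : count_below S g = i.+1.
  by have := count_below_l; rewrite count_belowS (negbTE gS) addn0 il.
have C := count_belowC S g.
have ig : i < g by lia.
split=> //; have [nSF cF] := F_spec ig.
have mg : m i < g.
  rewrite ltn_neqAle m_le_genus ?il// andbT -il; apply/eqP => mg.
  by move/negP: gS; apply; rewrite -/g -mg; apply/mem_set/m_mem.
apply: (leq_trans mg); rewrite leqNgt.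
apply/negP => /(@count_below_lt (~` S) _ _ nSF).
lia.
Qed.

Lemma m_lt_F_odd i : 2 * i + 1 < L_ S -> i < g /\ m i.+1 < F i.+1.
Proof.
move=> iL; have il : i < l_ S by move: iL; rewrite /L_; case: ifP => _; lia.
have [ig gF] := F_gt_genus il; split=> //.
exact: leq_ltn_trans (m_le_genus il) gF.
Qed.

Lemma gap_le_F1 x : 0 < g -> ~ S x -> x <= F 1.
Proof.
move=> g0 nSx; have [nSF cF] := F_spec g0.
rewrite leqNgt; apply/negP => /(@count_below_lt (~` S) _ _ nSF) Fx.
have := @count_below_lt (~` S) _ _ nSx (ltnSn x).
have := gaps_below_le x.+1 hS; rewrite -/g; lia.
Qed.

Lemma F_decr i : i.+1 < g -> F i.+2 < F i.+1.
Proof.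
move=> ig; have [_ cF] := F_spec (ltnW ig); have [_ cF'] := F_spec ig.
rewrite ltnNge; apply/negP => /(count_below_le (~` S)); lia.
Qed.

Lemma gap_le_F i x : i.+1 < g -> ~ S x -> x < F i.+1 -> x <= F i.+2.
Proof.
move=> ig nSx xF; have [_ cF] := F_spec (ltnW ig); have [nSF' cF'] := F_spec ig.
rewrite leqNgt; apply/negP => /(@count_below_lt (~` S) _ _ nSF').
have := @count_below_lt (~` S) _ _ nSx xF; lia.
Qed.

(** * Explicit shapes of the iterates, with their Frobenius number and genus *)

Definition even_shape i T := forall y, T y <-> S (y + m i) \/ F i.+1 < y + m i.

(** Subtraction is truncated: for y >= F_(i+1) the difference is 0, the strict inequality fails, and
    y belongs to T. *)
Definition odd_shape i T :=
  forall y, ~ T y <-> m i < F i.+1 - y /\ S (F i.+1 - y).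

Lemma even_shape_Frobenius i T : numerical_semigroup T -> 2 * i < L_ S ->
  even_shape i T -> ~ T (F i.+1 - m i) /\ Frobenius T = F i.+1 - m i.
Proof.
move=> hT /m_lt_F_even[ig mF] TE; have [nSF _] := F_spec ig.
have nT : ~ T (F i.+1 - m i).
  by move/TE; rewrite (subnK (ltnW mF)) => -[//|]; rewrite ltnn.
split=> //; apply: Frobenius_eq => // x Fx; apply/TE; right; lia.
Qed.

Lemma odd_shape_Frobenius i T : numerical_semigroup T -> 2 * i + 1 < L_ S ->
  odd_shape i T -> ~ T (F i.+1 - m i.+1) /\ Frobenius T = F i.+1 - m i.+1.
Proof.
move=> hT /m_lt_F_odd[ig mF] TE; have [Sm mm mmin] := m_succ i.
have nT : ~ T (F i.+1 - m i.+1) by apply/TE; rewrite (subKn (ltnW mF)).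
split=> //; apply: Frobenius_eq => // x Fx.
apply: contrapT => /TE[mx /mmin/(_ mx)]; lia.
Qed.

(** Translation by m_i sends the gaps of T to the gaps of S in [m_i, F_(i+1)]. Of the g gaps of S, i
    lie above F_(i+1) and m_i - i lie below m_i. *)
Lemma even_shape_genus i T : 2 * i < L_ S -> even_shape i T ->
  genus T + m i = g.
Proof.
move=> /m_lt_F_even[ig mF] TE; have [nSF cF] := F_spec ig.
rewrite (@card_gaps_count T (F i.+1 - m i).+1); last first.
  by move=> x Fx; apply/TE; right; lia.
have /(count_below_cat (~` S)) : m i <= (F i.+1).+1 by lia.
rewrite count_belowS (@mem_set _ (~` S))//.
rewrite -[X in \sum_(X <= _ < _) _]add0n big_addn subSn; last exact: ltnW.
rewrite (_ : \sum_(_ <= _ < _) _ = count_below (~` T) (F i.+1 - m i).+1).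
  have := count_belowC S (m i); rewrite count_below_m; lia.
apply: eq_big_nat => x /andP[_ xF]; rewrite !in_setC; congr (nat_of_bool (~~ _)).
apply/idP/idP => /set_mem; first by move=> ?; apply/mem_set/TE; left.
by move=> /TE[?|?]; [exact: mem_set | lia].
Qed.

(** The gaps of T mirror the elements of S strictly between m_i and F_(i+1). Below F_(i+1) there are
    F_(i+1) - (g - i - 1) elements of S, and i + 1 of them are m_0, ..., m_i. *)
Lemma odd_shape_genus i T : 2 * i + 1 < L_ S -> odd_shape i T ->
  genus T + g = F i.+1.
Proof.
move=> /m_lt_F_odd[ig mF] TE; have [nSF cF] := F_spec ig.
have [Sm mm _] := m_succ i.
rewrite (@card_gaps_count T (F i.+1 - m i)); last first.
  by move=> x Fx; apply: contrapT => /TE[]; lia.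
have /(count_below_cat S) : (m i).+1 <= (F i.+1).+1 by lia.
rewrite !count_belowS memNset// mem_set ?count_below_m; last exact: m_mem.
(* Shifting and reversing the sum carries out the substitution of F_(i+1) - x for x. *)
rewrite -[X in \sum_(X <= _ < _) _]add0n big_addn subSS big_nat_rev/=.
rewrite (_ : \sum_(_ <= _ < _) _ = count_below (~` T) (F i.+1 - m i)).
  have := count_belowC S (F i.+1); lia.
apply: eq_big_nat => x /andP[_ xF]; congr (nat_of_bool _).
have -> : 0 + (F i.+1 - m i) - x.+1 + (m i).+1 = F i.+1 - x by lia.
apply/idP/idP => /set_mem; first by move=> ?; apply/mem_set/TE; split=> //; lia.
by move=> /TE[_ ?]; exact: mem_set.
Qed.

(** Reflecting s - m_i in the Frobenius number F_(i+1) - m_i gives F_(i+1) - s: the shift by m_i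
    cancels. *)
Lemma odd_shape_Astar i T : 2 * i < L_ S -> almost_symmetric T ->
  even_shape i T -> odd_shape i (Astar T).
Proof.
move=> iL aT TE y; have [hT _ _] := aT.
have [_ FE] := even_shape_Frobenius hT iL TE.
have [ig mF] := m_lt_F_even iL.
rewrite almost_symmetric_Astar// FE; split=> [[yF /TE]|[mFy SFy]].
  have -> : F i.+1 - m i - y + m i = F i.+1 - y by lia.
  by move=> [?|?]; last lia; split=> //; lia.
split; first lia.
by apply/TE; left; have -> : F i.+1 - m i - y + m i = F i.+1 - y by lia.
Qed.

(** The second reflection, in F_(i+1) - m_(i+1), undoes the first up to a shift by m_(i+1). It
    leaves the gaps of S strictly below F_(i+1), that is, those up to F_(i+2). *)
Lemma even_shape_Astar i T : 2 * i.+1 < L_ S -> almost_symmetric T ->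
  odd_shape i T -> even_shape i.+1 (Astar T).
Proof.
move=> iL aT TE y; have [hT _ _] := aT; have iL' : 2 * i + 1 < L_ S by lia.
have [_ FE] := odd_shape_Frobenius hT iL' TE.
have [_ mF] := m_lt_F_odd iL'; have [ig _] := m_lt_F_even iL.
have [_ mm _] := m_succ i; have FF := F_decr ig.
have nA : ~ Astar T y <-> y + m i.+1 < F i.+1 /\ ~ S (y + m i.+1).
  rewrite almost_symmetric_Astar// FE; split=> [[yF TF]|[yF nS]].
    split=> [|Sy]; first lia.
    suff : ~ T (F i.+1 - m i.+1 - y) by [].
    apply/TE; have -> : F i.+1 - (F i.+1 - m i.+1 - y) = y + m i.+1 by lia.
    by split=> //; lia.
  split; first lia.
  apply: contrapT => /TE[_].
  by have -> : F i.+1 - (F i.+1 - m i.+1 - y) = y + m i.+1 by lia.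
split=> [Ay|SF].
  have [Sy|nSy] := pselect (S (y + m i.+1)); [by left | right].
  rewrite ltnNge; apply/negP => yF; suff : ~ Astar T y by [].
  by apply/nA; split=> //; lia.
apply: contrapT => /nA[yF nSy]; case: SF => // SF.
by have := gap_le_F ig nSy yF; lia.
Qed.

(** * Shapes along the iteration and the resulting type formulas *)

Lemma Astar_iter_shape i :
  (2 * i < L_ S -> (forall j, j < 2 * i -> almost_symmetric (Astar_iter j S)) ->
    even_shape i (Astar_iter (2 * i) S)) /\
  (2 * i + 1 < L_ S ->
    (forall j, j < 2 * i + 1 -> almost_symmetric (Astar_iter j S)) ->
    odd_shape i (Astar_iter (2 * i + 1) S)).
Proof.
(* The two statements alternate: the odd one at i yields the even one at i + 1, which in turn yields
   the odd one at i + 1. *)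
elim: i => [|i [_ IH]].
  have E : 0 < L_ S -> even_shape 0 S.
    move=> /(@m_lt_F_even 0)[g0 _] y; rewrite addn0; split; first by left.
    by case=> // Fy; apply: contrapT => /(gap_le_F1 g0); rewrite leqNgt Fy.
  split=> [L0 _|L0 aS]; first exact: E.
  by apply: odd_shape_Astar; [lia|exact: (aS 0)|apply: E; lia].
have E : 2 * i.+1 < L_ S ->
    (forall j, j < 2 * i.+1 -> almost_symmetric (Astar_iter j S)) ->
    even_shape i.+1 (Astar_iter (2 * i.+1) S).
  have -> : 2 * i.+1 = (2 * i + 1).+1 by lia.
  move=> iL aS.
  apply: (@even_shape_Astar _ (Astar_iter (2 * i + 1) S)); [lia|exact: aS|].
  by apply: IH => [|j ji]; [lia|apply: aS; lia].
split=> // iL aS; rewrite addn1.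
apply: (@odd_shape_Astar _ (Astar_iter (2 * i.+1) S)); [lia|apply: aS; lia|].
by apply: E => [|j ji]; [lia|apply: aS; lia].
Qed.

(** The iterate has genus g - m_i and Frobenius number F_(i+1) - m_i, and 2(g - m_i) - (F_(i+1) -
    m_i) = 2g - m_i - F_(i+1). *)
Lemma almost_symmetric_even i : 2 * i < L_ S ->
  (forall j, j < 2 * i -> almost_symmetric (Astar_iter j S)) ->
  almost_symmetric (Astar_iter (2 * i) S) <->
  (Posz (sg_type (Astar_iter (2 * i) S))
   = 2 * Posz (genus S) - Posz (m_ i S) - Posz (F_ i.+1 S))%R.
Proof.
move=> iL /((Astar_iter_shape i).1 iL) TE.
have hT := numerical_semigroup_Astar_iter (2 * i) hS.
have [nT FT] := even_shape_Frobenius hT iL TE.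
have gT := even_shape_genus iL TE; have [_ mF] := m_lt_F_even iL.
split=> [[_ _ ->]|tE]; last split=> //; first 1 last.
- by move=> T1; apply: nT; rewrite T1.
- by rewrite tE FT; move: gT mF; rewrite /g /m /F; lia.
- by rewrite FT; move: gT mF; rewrite /g /m /F; lia.
Qed.

(** Here the genus is F_(i+1) - g and the Frobenius number F_(i+1) - m_(i+1), so twice the former
    minus the latter is F_(i+1) - 2g + m_(i+1). *)
Lemma almost_symmetric_odd i : 2 * i + 1 < L_ S ->
  (forall j, j < 2 * i + 1 -> almost_symmetric (Astar_iter j S)) ->
  almost_symmetric (Astar_iter (2 * i + 1) S) <->
  (Posz (sg_type (Astar_iter (2 * i + 1) S))
   = Posz (F_ i.+1 S) - 2 * Posz (genus S) + Posz (m_ i.+1 S))%R.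
Proof.
move=> iL /((Astar_iter_shape i).2 iL) TE.
have hT := numerical_semigroup_Astar_iter (2 * i + 1) hS.
have [nT FT] := odd_shape_Frobenius hT iL TE.
have gT := odd_shape_genus iL TE; have [_ mF] := m_lt_F_odd iL.
split=> [[_ _ ->]|tE]; last split=> //; first 1 last.
- by move=> T1; apply: nT; rewrite T1.
- by rewrite tE FT; move: gT mF; rewrite /g /m /F; lia.
- by rewrite FT; move: gT mF; rewrite /g /m /F; lia.
Qed.

End invariants.

Theorem theorem1p4 (S : set nat) (hS : numerical_semigroup S)
    (k : nat) (hk : k < L_ S) :
  (forall j : nat, j <= k -> almost_symmetric (Astar_iter j S)) <->
  ((forall i : nat, 2 * i <= k ->
      (Posz (sg_type (Astar_iter (2 * i)%N S))
       = 2 * Posz (genus S) - Posz (m_ i S) - Posz (F_ i.+1 S))%R) /\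
   (forall i : nat, 2 * i + 1 <= k ->
      (Posz (sg_type (Astar_iter (2 * i + 1)%N S))
       = Posz (F_ i.+1 S) - 2 * Posz (genus S) + Posz (m_ i.+1 S))%R)).
Proof.
split=> [aS|[even_t odd_t]].
  split=> i ik.
    apply/almost_symmetric_even => //; first exact: leq_ltn_trans hk.
      by move=> j ji; apply: aS; lia.
    exact: aS.
  apply/almost_symmetric_odd => //; first exact: leq_ltn_trans hk.
    by move=> j ji; apply: aS; lia.
  exact: aS.
elim/ltn_ind => j IH jk.
have aS l : l < j -> almost_symmetric (Astar_iter l S).
  by move=> lj; apply: IH => //; exact: leq_trans (ltnW lj) jk.
have jL := leq_ltn_trans jk hk.
have [i [jE|jE]] : exists i, j = 2 * i \/ j = 2 * i + 1.
- by exists j./2; have := odd_double_half j; case: (odd j); lia.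
- by move: aS jL jk; rewrite jE => aS jL /even_t/almost_symmetric_even; exact.
- by move: aS jL jk; rewrite jE => aS jL /odd_t/almost_symmetric_odd; exact.
Qed.
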